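(* Let $G$ be a finite simple graph with $n\ge1$ vertices and $m\ge1$ edges, and let $F_V:\{0,1,2,\dots\}\to(0,\infty)$ and $F_E:\{0,1,2,\dots\}^2\to(0,\infty)$ be functions. Then $$X_{\Sigma,F_V^2}(G)+n(n-1)X_{\Pi,F_V}(G)^{2/n}\le X_{\Sigma,F_V}(G)^2\le (n-1)X_{\Sigma,F_V^2}(G)+nX_{\Pi,F_V}(G)^{2/n},$$ $$X_{\Sigma,F_E^2}(G)+m(m-1)X_{\Pi,F_E}(G)^{2/m}\le X_{\Sigma,F_E}(G)^2\le (m-1)X_{\Sigma,F_E^2}(G)+mX_{\Pi,F_E}(G)^{2/m}.$$
   Context: For a graph $G$ with vertex set $V(G)$ and edge set $E(G)$, $d_u$ denotes the degree of the vertex $u$ and $uv$ denotes the edge joining $u$ and $v$. For a function $F_V$ of one variable and a function $F_E$ of two variables, $X_{\Sigma,F_V}(G)=\sum_{u\in V(G)}F_V(d_u)$, $X_{\Sigma,F_E}(G)=\sum_{uv\in E(G)}F_E(d_u,d_v)$, $X_{\Pi,F_V}(G)=\prod_{u\in V(G)}F_V(d_u)$, and $X_{\Pi,F_E}(G)=\prod_{uv\in E(G)}F_E(d_u,d_v)$. Since $F_E(d_u,d_v)$ is evaluated on unordered edges, $F_E$ is assumed symmetric: $F_E(x,y)=F_E(y,x)$. The notation $F_V^2$ means the function $x\mapsto F_V(x)^2$, and $F_E^2$ means $(x,y)\mapsto F_E(x,y)^2$. *)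

(* Defs.v *)
From mathcomp Require Import all_boot all_order all_algebra.
From mathcomp Require Import reals exp.

Set Implicit Arguments.
Unset Strict Implicit.
Unset Printing Implicit Defensive.

Import Order.TTheory GRing.Theory Num.Theory.
Local Open Scope ring_scope.

Record sgraph := SGraph {
  vertex :> finType;
  adj : rel vertex;
  adj_sym : symmetric adj;
  adj_irrefl : irreflexive adj
}.

Section Graph.
Variable G : sgraph.

Definition degree (u : G) : nat := #|[set v : G | adj u v]|.

Definition edges : {set {set G}} :=
  [set [set p.1; p.2] | p : G * G & adj p.1 p.2].

Variable R : realType.

(* F (d_u) (d_v) for the edge e = {u, v}. The order in which the two endpoints
   are picked is arbitrary, so this is meaningful for symmetric F; see
   [edge_valueE]. The default value 0 is never reached on edges. *)
Definition edge_value (F : nat -> nat -> R) (e : {set G}) : R :=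
  if [pick p : G * G | e == [set p.1; p.2]] is Some p
  then F (degree p.1) (degree p.2) else 0.

Definition XsumV (F : nat -> R) : R := \sum_(u : G) F (degree u).
Definition XprodV (F : nat -> R) : R := \prod_(u : G) F (degree u).
Definition XsumE (F : nat -> nat -> R) : R := \sum_(e in edges) edge_value F e.
Definition XprodE (F : nat -> nat -> R) : R := \prod_(e in edges) edge_value F e.

Lemma edge_valueE (F : nat -> nat -> R) (u v : G) :
  (forall x y, F x y = F y x) ->
  edge_value F [set u; v] = F (degree u) (degree v).
Proof.
move=> Fsym; rewrite /edge_value; case: pickP => [[a b] /= /eqP E|/(_ (u, v))];
  last by rewrite eqxx.
have: u \in [set a; b] by rewrite -E set21.
have: v \in [set a; b] by rewrite -E set22.
have: a \in [set u; v] by rewrite E set21.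
have: b \in [set u; v] by rewrite E set22.
rewrite !inE.
by do 4![case/orP=> /eqP ?]; subst=> //; apply: Fsym.
Qed.

Lemma mem_edges (u v : G) : ([set u; v] \in edges) = adj u v.
Proof.
apply/imsetP/idP => [[[a b]]|uv]; last by exists (u, v); rewrite ?inE.
rewrite inE /= => ab E.
have: u \in [set a; b] by rewrite -E set21.
have: v \in [set a; b] by rewrite -E set22.
have: a \in [set u; v] by rewrite E set21.
have: b \in [set u; v] by rewrite E set22.
rewrite !inE.
by do 4![case/orP=> /eqP ?]; subst=> //; rewrite adj_sym.
Qed.

End Graph.

(* Main.v *)
(* Both bounds are inequalities for positive reals x_1, ..., x_n with geometric
   mean g, namely  S2 + n (n - 1) g^2 <= S1^2 <= (n - 1) S2 + n g^2,  where S1 is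
   the sum of the x_i and S2 the sum of their squares.  Induct on n, adjoining x
   to a family of m = n - 1 numbers y_i with geometric mean h, so that
   g^n = h^m x.
   Lower bound: the increment 2 x (sum y_i) + m (m - 1) h^2 is at least
   m (2 x h + (m - 1) h^2) >= m (m + 1) g^2, by AM-GM twice.
   Upper bound (Kober): let x be the smallest number.  What has to be shown is
   sum (y_i - x)^2 - x^2 + n g^2 - m h^2 >= 0.  Since x <= h <= mean of y,
   Cauchy-Schwarz gives sum (y_i - x)^2 >= m (h - x)^2, and what is left,
   (m - 1) x^2 + (m + 1) g^2 >= 2 m h x, is AM-GM again. *)
Require Import Defs.
From mathcomp Require Import all_boot all_order all_algebra.
From mathcomp Require Import reals exp.
From mathcomp Require Import ring lra.

Set Implicit Arguments.
Unset Strict Implicit.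
Unset Printing Implicit Defensive.

Import Order.TTheory GRing.Theory Num.Theory.
Local Open Scope ring_scope.

Section Kober.
Variable R : realType.
Implicit Types (s : seq R) (x g h : R) (n m : nat).

(** AM-GM without roots: the geometric mean enters only through the power equation for [g], so later
    uses stay polynomial. *)
Lemma AGM_seq s g : all (fun x => 0 <= x) s -> 0 <= g ->
  g ^+ size s = \prod_(x <- s) x -> (size s)%:R * g <= \sum_(x <- s) x.
Proof.
have [->|s_neq0] := eqVneq s [::]; first by rewrite /= mul0r !big_nil.
move=> /allP s_ge0 g_ge0; rewrite (big_nth 0) big_mkord => gE.
rewrite (big_nth 0) big_mkord.
have size_gt0 : (0 < size s)%N by rewrite lt0n size_eq0.
have sizeR_gt0 : 0 < (size s)%:R :> R by rewrite ltr0n.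
have nth_ge0 i : (i < size s)%N -> 0 <= s`_i by move=> i_lt; apply/s_ge0/mem_nth.
have := @leif_AGM R 'I_(size s) predT (fun i => s`_i)
  (fun i _ => nth_ge0 _ (ltn_ord i)).
case=> + _; rewrite card_ord -gE ler_pXn2r ?nnegrE//; last first.
  by apply: divr_ge0 => //; apply: sumr_ge0 => i _; apply: nth_ge0.
by rewrite ler_pdivlMr// mulrC.
Qed.

(** Weighted AM-GM with integer weights: [AGM_seq] for [n] copies of [x] and [m] copies of [y]. *)
Lemma AGM_two n m x y g : 0 <= x -> 0 <= y -> 0 <= g ->
  g ^+ (n + m) = x ^+ n * y ^+ m -> (n + m)%:R * g <= n%:R * x + m%:R * y.
Proof.
move=> x_ge0 y_ge0 g_ge0 gE.
have := @AGM_seq (nseq n x ++ nseq m y) g.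
rewrite all_cat !all_nseq x_ge0 y_ge0 !orbT size_cat !size_nseq => /(_ isT g_ge0).
rewrite !big_cat !big_nseq -!Monoid.iteropE /= !mulr_natl; apply.
by rewrite gE.
Qed.

Lemma geometric_mean_exists s : all (fun x => 0 < x) s -> s != [::] ->
  exists2 h : R, 0 < h & h ^+ size s = \prod_(x <- s) x.
Proof.
move=> s_gt0 s_neq0; have P_gt0 : 0 < \prod_(x <- s) x.
  by rewrite big_seq prodr_gt0// => x; apply: (allP s_gt0).
exists ((\prod_(x <- s) x) `^ (size s)%:R^-1); first exact: powR_gt0.
rewrite -powR_mulrn ?powR_ge0// -powRrM mulVf ?powRr1 ?ltW//.
by rewrite pnatr_eq0 size_eq0.
Qed.

Lemma sqr_sum_ge s g : all (fun x => 0 < x) s -> 0 < g ->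
  g ^+ size s = \prod_(x <- s) x ->
  \sum_(x <- s) x ^+ 2 + (size s)%:R * ((size s)%:R - 1) * g ^+ 2
    <= (\sum_(x <- s) x) ^+ 2.
Proof.
elim: s g => [|x s IH] g; first by rewrite !big_nil /= !mul0r addr0 expr0n.
have [->|s_neq0] := eqVneq s [::].
  by move=> _ _ _; rewrite !big_seq1 /= subrr mulr0 mul0r addr0.
move=> /= /andP[x_gt0 s_gt0] g_gt0; rewrite !big_cons => gE.
have [h h_gt0 hE] := geometric_mean_exists s_gt0 s_neq0.
have {}IH := IH h s_gt0 h_gt0 hE.
have s_ge0 : all (fun x => 0 <= x) s by apply: sub_all s_gt0 => y /ltW.
have hA := AGM_seq s_ge0 (ltW h_gt0) hE.
case: (size s) (size_eq0 s) hE gE IH hA => [|m]; first by rewrite eqxx (negPf s_neq0).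
move=> _ hE gE IH hA.
(* The tail now has [m.+1] entries, one more than [m]. The products agree because
   [g ^+ m.+2 = x * h ^+ m.+1]. *)
have : (2 + m)%:R * g ^+ 2 <= 2%:R * (x * h) + m%:R * h ^+ 2.
  apply: AGM_two; rewrite ?sqr_ge0 ?mulr_ge0 ?(ltW x_gt0) ?(ltW h_gt0)//.
  rewrite exprAC [g ^+ _]gE -hE (exprS h) (exprAC h); move: (h ^+ m) => k.
  by ring.
have {}hA : x * (m.+1%:R * h) <= x * \sum_(y <- s) y by rewrite ler_pM2l.
(* After scaling by [m.+1], the goal is the sum of [IH], twice [hA], and [hB]. *)
rewrite -(@ler_pM2l _ m.+1%:R) ?ltr0n// => hB.
move: IH hA hB; rewrite natrD -!natr1; set S1 := \sum_(y <- s) y.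
by set S2 := \sum_(y <- s) _ => IH hA hB; nra.
Qed.

Lemma sum_sqr_sub s x : \sum_(y <- s) (y - x) ^+ 2
  = \sum_(y <- s) y ^+ 2 - 2 * x * (\sum_(y <- s) y) + (size s)%:R * x ^+ 2.
Proof. by elim: s => [|y s IH]; rewrite ?big_nil ?big_cons /= ?IH -?natr1; ring. Qed.

(** Cauchy-Schwarz against the constant 1: adjoining [x] widens the gap by exactly the sum of the
    [(y - x) ^+ 2]. *)
Lemma sqr_sum_le_sum_sqr s :
  (\sum_(x <- s) x) ^+ 2 <= (size s)%:R * \sum_(x <- s) x ^+ 2.
Proof.
elim: s => [|x s IH]; first by rewrite !big_nil mul0r expr0n.
have : 0 <= \sum_(y <- s) (y - x) ^+ 2 by apply: sumr_ge0 => y _; apply: sqr_ge0.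
rewrite sum_sqr_sub; rewrite !big_cons /= -natr1; move: IH; nra.
Qed.

(** Sorting makes the head the smallest entry, and the tail stays sorted, so list induction always
    adjoins a minimum. *)
Lemma sqr_sum_le_sorted s g : sorted <=%R s -> all (fun x => 0 < x) s -> 0 < g ->
  g ^+ size s = \prod_(x <- s) x ->
  (\sum_(x <- s) x) ^+ 2
    <= ((size s)%:R - 1) * \sum_(x <- s) x ^+ 2 + (size s)%:R * g ^+ 2.
Proof.
elim: s g => [|x s IH] g; first by rewrite !big_nil /= mulr0 mul0r addr0 expr0n.
have [->|s_neq0] := eqVneq s [::].
  by move=> _ _ _; rewrite !big_seq1 /= subrr mul0r add0r mul1r expr1 => ->.
move=> /= xs_sorted /andP[x_gt0 s_gt0] g_gt0; rewrite !big_cons => gE.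
have [h h_gt0 hE] := geometric_mean_exists s_gt0 s_neq0.
have {}IH := IH h (path_sorted xs_sorted) s_gt0 h_gt0 hE.
have s_ge0 : all (fun x => 0 <= x) s by apply: sub_all s_gt0 => y /ltW.
have hA := AGM_seq s_ge0 (ltW h_gt0) hE.
have x_le_s := allP (order_path_min le_trans xs_sorted).
have size_gt0 : (0 < size s)%N by rewrite lt0n size_eq0.
(* Compare [size s]-th powers, factor by factor: [x] is below every entry of [s]. *)
have xh : x <= h.
  rewrite -(ler_pXn2r size_gt0) ?nnegrE ?(ltW x_gt0) ?(ltW h_gt0)// hE.
  have -> : x ^+ size s = \prod_(y <- s) x.
    by rewrite big_const_seq count_predT -Monoid.iteropE.
  rewrite big_seq [leRHS]big_seq; apply: ler_prod => y ys.
  by rewrite (ltW x_gt0) x_le_s.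
have CS := sqr_sum_le_sum_sqr [seq y - x | y <- s].
rewrite !big_map size_map sum_sqr_sub sumrB in CS.
rewrite (_ : \sum_(i <- s) x = (size s)%:R * x) in CS; last first.
  by rewrite big_const_seq count_predT iter_addr_0 mulr_natl.
case: (size s) size_gt0 hE gE IH hA CS => // m _ hE gE IH hA CS.
(* Both sides of the power equation are [(x * h) ^+ (2 * m.+1)], since
   [g ^+ m.+2 = x * h ^+ m.+1]. *)
have : (m + m.+2)%:R * (x * h) <= m%:R * x ^+ 2 + m.+2%:R * g ^+ 2.
  apply: AGM_two; rewrite ?sqr_ge0 ?mulr_ge0 ?(ltW x_gt0) ?(ltW h_gt0)//.
  have -> : (m + m.+2 = m.+1 * 2)%N by rewrite muln2 -addnn addnS.
  rewrite exprM exprMn (exprAC g) gE -hE !(exprS _ m) (exprAC x).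
  by move: (h ^+ m) (x ^+ m) => k l; ring.
move: IH hA CS; set S1 := \sum_(y <- s) y; set S2 := \sum_(y <- s) _ => IH hA CS hB.
(* By [hA], [m.+1%:R * (h - x)] is at most the sum of the shifted entries; [xh] makes it
   nonnegative, so squaring keeps the order. *)
have {CS} : m.+1%:R * (h - x) ^+ 2 <= S2 - 2 * x * S1 + m.+1%:R * x ^+ 2.
  rewrite -(@ler_pM2l _ m.+1%:R) ?ltr0n//; apply: le_trans CS.
  rewrite mulrA -expr2 -exprMn ler_pXn2r ?nnegrE// ?mulr_ge0 ?subr_ge0//.
    by rewrite mulrBr lerB.
  by apply: le_trans hA; rewrite ler_pM2l ?ltr0n.
(* The goal is the sum of [IH], [hB] and the bound just proved. *)
by move: IH hB; rewrite natrD -!natr1; nra.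
Qed.

(** Every term is invariant under permutation, so the list may be sorted first. *)
Lemma sqr_sum_le s g : all (fun x => 0 < x) s -> 0 < g ->
  g ^+ size s = \prod_(x <- s) x ->
  (\sum_(x <- s) x) ^+ 2
    <= ((size s)%:R - 1) * \sum_(x <- s) x ^+ 2 + (size s)%:R * g ^+ 2.
Proof.
have ps : perm_eq s (sort <=%R s) by rewrite perm_sym perm_sort.
rewrite (perm_all _ ps) !(perm_big _ ps) (perm_size ps).
exact: sqr_sum_le_sorted (sort_le_sorted s).
Qed.

Lemma sqr_sum_bounds (T : finType) (A : {pred T}) (F : T -> R) n :
  n = #|A| -> (1 <= n)%N -> {in A, forall i, 0 < F i} ->
  \sum_(i in A) F i ^+ 2
      + n%:R * (n%:R - 1) * ((\prod_(i in A) F i) `^ (2 / n%:R))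
    <= (\sum_(i in A) F i) ^+ 2
  /\ (\sum_(i in A) F i) ^+ 2
    <= (n%:R - 1) * \sum_(i in A) F i ^+ 2
       + n%:R * ((\prod_(i in A) F i) `^ (2 / n%:R)).
Proof.
move=> nE n_gt0 F_gt0; pose s := [seq F i | i <- enum A].
have s_gt0 : all (fun x => 0 < x) s.
  by apply/allP => _ /mapP[i + ->]; rewrite mem_enum => /F_gt0.
have s_size : size s = n by rewrite size_map -cardE.
have s_neq0 : s != [::] by rewrite -size_eq0 s_size -lt0n.
have [g g_gt0 gE] := geometric_mean_exists s_gt0 s_neq0.
(* The product is [g ^+ n], and the exponents [n] and [2 / n] multiply to 2. *)
have -> : (\prod_(i in A) F i) `^ (2 / n%:R) = g ^+ 2.
  rewrite -big_enum -(big_map F predT id) -gE s_size -powR_mulrn ?ltW//.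
  by rewrite -powRrM mulrC divfK ?pnatr_eq0 -?lt0n// powR_mulrn// ltW.
have := sqr_sum_ge s_gt0 g_gt0 gE; have := sqr_sum_le s_gt0 g_gt0 gE.
by rewrite !big_map !big_enum s_size.
Qed.
End Kober.

Theorem theorem5 (R : realType) (G : sgraph) (n m : nat)
    (FV : nat -> R) (FE : nat -> nat -> R)
    (hn : n = #|G|) (n_ge1 : (1 <= n)%N)
    (hm : m = #|edges G|) (m_ge1 : (1 <= m)%N)
    (FV_gt0 : forall x, 0 < FV x)
    (FE_gt0 : forall x y, 0 < FE x y)
    (FE_sym : forall x y, FE x y = FE y x) :
  (XsumV G (fun x => FV x ^+ 2)
     + n%:R * (n%:R - 1) * (XprodV G FV `^ (2 / n%:R)) <= XsumV G FV ^+ 2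
   /\ XsumV G FV ^+ 2 <= (n%:R - 1) * XsumV G (fun x => FV x ^+ 2)
     + n%:R * (XprodV G FV `^ (2 / n%:R)))
  /\
  (XsumE G (fun x y => FE x y ^+ 2)
     + m%:R * (m%:R - 1) * (XprodE G FE `^ (2 / m%:R)) <= XsumE G FE ^+ 2
   /\ XsumE G FE ^+ 2 <= (m%:R - 1) * XsumE G (fun x y => FE x y ^+ 2)
     + m%:R * (XprodE G FE `^ (2 / m%:R))).
Proof.
have edge_value_gt0 : {in edges G, forall e, 0 < edge_value FE e}.
  by move=> _ /imsetP[[u v] _ ->]; rewrite edge_valueE.
(* The square of [FE] inherits its symmetry, so [edge_valueE] evaluates both sides at the same
   endpoints. *)
have edge_value_sqr : {in edges G,
    forall e, edge_value (fun x y => FE x y ^+ 2) e = edge_value FE e ^+ 2}.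
  by move=> _ /imsetP[[u v] _ ->]; rewrite !edge_valueE// => x y; rewrite FE_sym.
split; last first.
  rewrite /XsumE (eq_bigr _ edge_value_sqr).
  exact: sqr_sum_bounds.
by have := @sqr_sum_bounds R G predT (fun u => FV (degree u)) n; apply.
Qed.
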